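(* Let $\mathcal F$ be a family of $6$ line-segments in $\mathbb{R}^2$ with pairwise disjoint relative interiors. Suppose that no line meets $\bigcup\mathcal F$ in exactly two points and that the graph $G(\mathcal F)$ is $3$-connected. Then there are non-collinear points $a,b,c$ such that $\mathcal F=\{ab,bc,ca,A,B,C\}$, where $A=aa'$, $B=bb'$, $C=cc'$ are line-segments, and, after a suitable relabeling of $a,b,c$, exactly one of the following four combinatorial types occurs: (a) $a'=b'=c'$ (the three segments $A,B,C$ have a common endpoint); (b) $a'=b'=:e$, the point $e$ lies in the relative interior of $C$, and $c'$ lies in the relative interior of the side $ab$; (c) $b'$ lies in the relative interior of $A$, $c'$ lies in the relative interior of $B$, and $a'$ lies in the relative interior of $C$; (d) $a'$ lies in the relative interior of the side $bc$, and both $b'$ and $c'$ lie in the relative interior of $A$.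
   Context: Line-segments are closed and nondegenerate; for points $x,y$, $xy$ denotes the line-segment joining them. For a finite family $\mathcal F$ of line-segments in the plane with pairwise disjoint relative interiors, $\bigcup\mathcal F$ is regarded as a planar geometric graph $G(\mathcal F)$: its vertex set is the set of all endpoints of segments of $\mathcal F$, and each segment $S\in\mathcal F$ is subdivided by the vertices lying on it into edges joining consecutive vertices along $S$. A graph is $3$-connected if it has at least four vertices and remains connected after deleting any two vertices. *)

(* Defs.v *)
From mathcomp Require Import all_boot all_order all_algebra.
From mathcomp Require Import boolp classical_sets functions cardinality.
From mathcomp Require Import set_interval reals.
From Stdlib Require Import Relation_Operators.

Set Implicit Arguments.
Unset Strict Implicit.
Unset Printing Implicit Defensive.

Import Order.TTheory GRing.Theory Num.Theory.
Local Open Scope ring_scope.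
Local Open Scope classical_set_scope.
Local Open Scope card_scope.

Definition segment (R : realType) (x y : 'rV[R]_2) : set 'rV[R]_2 :=
  [set (1 - t) *: x + t *: y | t in `[0, 1]].

Definition is_segment (R : realType) (S : set 'rV[R]_2) : Prop :=
  exists x y : 'rV[R]_2, x <> y /\ S = segment x y.

Definition endpoints (R : realType) (S : set 'rV[R]_2) : set 'rV[R]_2 :=
  [set x | exists y : 'rV[R]_2, x <> y /\ S = segment x y].

(* Only meaningful when [is_segment S] holds. *)
Definition relint (R : realType) (S : set 'rV[R]_2) : set 'rV[R]_2 :=
  S `\` endpoints S.

Definition is_line (R : realType) (L : set 'rV[R]_2) : Prop :=
  exists x y : 'rV[R]_2,
    x <> y /\ L = [set (1 - t) *: x + t *: y | t in [set: R]].

Definition collinear (R : realType) (a b c : 'rV[R]_2) : Prop :=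
  exists L : set 'rV[R]_2, is_line L /\ [/\ L a, L b & L c].

(* The graph G(F): [vertices F] is its vertex set, and [adjacent F], restricted
   to the vertices, is its edge relation.  Two vertices are consecutive along a
   segment when no vertex lies strictly between them. *)
Definition vertices (R : realType) (F : set (set 'rV[R]_2)) : set 'rV[R]_2 :=
  \bigcup_(S in F) endpoints S.

Definition adjacent (R : realType) (F : set (set 'rV[R]_2))
    (u v : 'rV[R]_2) : Prop :=
  [/\ u <> v, exists S, [/\ F S, S u & S v]
    & relint (segment u v) `&` vertices F = set0].

(* The subgraph induced on [V] is connected. *)
Definition graph_connected (T : Type) (V : set T) (E : T -> T -> Prop) : Prop :=
  forall x y, V x -> V y ->
    clos_refl_trans T (fun u v => [/\ V u, V v & E u v]) x y.

Definition three_connected (T : Type) (V : set T) (E : T -> T -> Prop) : Prop :=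
  `I_4 #<= V /\
  forall u v, V u -> V v -> u <> v -> graph_connected (V `\` [set u; v]) E.

Inductive combinatorial_type := TypeA | TypeB | TypeC | TypeD.

(* The condition [b' <> c'] in [TypeD] makes the four types mutually exclusive:
   if b' = c', cyclically relabeling a, b, c gives a configuration of
   type [TypeB]. *)
Definition of_type (R : realType) (tau : combinatorial_type)
    (a b c a' b' c' : 'rV[R]_2) : Prop :=
  match tau with
  | TypeA => a' = b' /\ b' = c'
  | TypeB => [/\ a' = b', relint (segment c c') a' & relint (segment a b) c']
  | TypeC => [/\ relint (segment a a') b', relint (segment b b') c'
               & relint (segment c c') a']
  | TypeD => [/\ relint (segment b c) a', relint (segment a a') b',
                 relint (segment a a') c' & b' <> c']
  end.

(* Main.v *)
(** Call a vertex a corner if it lies in no relative interior.  Its neighbours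
    lie on distinct segments, so by 3-connectivity at least three segments end
    at it.  A linear functional restricted to the union attains its maximum at a
    corner, so the union lies in the convex hull of the corners, and three of
    them are not collinear.
    If there are four corners, they use up all twelve segment ends, so F is a
    complete graph on them, which is type (a).  Otherwise the corners are the
    vertices a, b, c of a triangle containing the union; a side absent from F
    would span a line meeting the union only in its two ends.  The remaining
    three segments start at a, b, c and each ends inside another segment, and
    the combinations in which two of them would cross are excluded.
    The types are told apart by whether some vertex subdivides a segment, two
    vertices subdivide the same segment, or some vertex subdividing a segment
    is an end of two others. *)

Require Import Defs.
From mathcomp Require Import all_boot all_order all_algebra.
From mathcomp Require Import boolp classical_sets functions cardinality.
From mathcomp Require Import set_interval reals.
From mathcomp Require Import ring lra.
From Stdlib Require Import Relation_Operators Operators_Properties.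

Set Implicit Arguments.
Unset Strict Implicit.
Unset Printing Implicit Defensive.

Import Order.TTheory GRing.Theory Num.Theory.
Local Open Scope ring_scope.
Local Open Scope classical_set_scope.
Local Open Scope card_scope.

Local Notation conv t x y := ((1 - t) *: x + t *: y).

(** * Segments in affine parameters: endpoints and relative interiors *)

Section Segments.
Variable R : realType.
Implicit Types (x y z w p q : 'rV[R]_2) (s t u : R) (S T : set 'rV[R]_2).

Lemma row2P x y : x 0 0 = y 0 0 -> x 0 1 = y 0 1 -> x = y.
Proof.
move=> e0 e1; apply/rowP => -[[|[|//]] lt2].
- by rewrite (_ : Ordinal lt2 = 0) //; apply: val_inj.
- by rewrite (_ : Ordinal lt2 = 1) //; apply: val_inj.
Qed.

Lemma conv0 x y : conv 0 x y = x.
Proof. by rewrite subr0 scale1r scale0r addr0. Qed.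

Lemma conv1 x y : conv 1 x y = y.
Proof. by rewrite subrr scale1r scale0r add0r. Qed.

Lemma convC t x y : conv t x y = conv (1 - t) y x.
Proof. by apply/rowP => i; rewrite !mxE; ring. Qed.

Lemma conv_conv s t u x y :
  conv s (conv t x y) (conv u x y) = conv ((1 - s) * t + s * u) x y.
Proof. by apply/rowP => i; rewrite !mxE; ring. Qed.

Lemma conv_inj x y : x <> y -> injective (fun t => conv t x y).
Proof.
move=> xy s t /= e.
have /eqP : (s - t) *: (y - x) = 0.
  have -> : (s - t) *: (y - x) = conv s x y - conv t x y.
    by apply/rowP => i; rewrite !mxE; ring.
  by rewrite e subrr.
by rewrite scaler_eq0 !subr_eq0 => /orP[/eqP //|/eqP /esym].
Qed.

Lemma segmentP x y p :
  segment x y p <-> exists t, [/\ 0 <= t, t <= 1 & p = conv t x y].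
Proof.
split=> [[t /=]|[t [t0 t1 ->]]].
  by rewrite in_itv /= => /andP[t0 t1] <-; exists t.
by exists t => //=; rewrite in_itv /= t0 t1.
Qed.

Lemma segment_l x y : segment x y x.
Proof. by apply/segmentP; exists 0; rewrite conv0. Qed.

Lemma segmentC x y : segment x y = segment y x.
Proof.
by apply/seteqP; split=> p /segmentP[t [t0 t1 ->]]; rewrite convC;
  apply/segmentP; exists (1 - t); split=> //; lra.
Qed.

Lemma segment_r x y : segment x y y.
Proof. by rewrite segmentC; exact: segment_l. Qed.

Lemma is_segmentP x y : is_segment (segment x y) <-> x <> y.
Proof.
split=> [[z [w [zw e]]] xy|xy]; last by exists x, y.
apply: zw; move: (segment_l z w) (segment_r z w); rewrite -e -xy.
move=> /segmentP[s [_ _ ->]] /segmentP[t [_ _ ->]].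
by rewrite -!scalerDl !subrK.
Qed.

(** If the same set is also described as [segment p z], then [x] and [y] have nonnegative parameters
    [s], [u] along it, and the parameter 0 of [p] is a weighted mean of them; both weighted terms
    vanish, so [p] is [x] or [y]. *)
Lemma endpoints_segment x y p :
  x <> y -> endpoints (segment x y) p <-> p = x \/ p = y.
Proof.
move=> xy; split=> [[z [pz e]]|[->|->]]; last 2 first.
- by exists y.
- by exists x; split; [exact: nesym | exact: segmentC].
move: (segment_l p z); rewrite -e => /segmentP[t [t0 t1 ep]].
move: (segment_l x y) (segment_r x y); rewrite e.
move=> /segmentP[s [s0 s1 ex]] /segmentP[u [u0 u1 ey]].
have e0 : (1 - t) * s + t * u = 0.
  by apply: (conv_inj pz); rewrite -conv_conv -ex -ey -ep conv0.
have : (1 - t) * s = 0 by nra.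
move/eqP; rewrite mulf_eq0 => /orP[/eqP t1'|/eqP s0'].
- by right; rewrite ep (_ : t = 1) ?conv1//; lra.
- by left; rewrite ex s0' conv0.
Qed.

Lemma relint_segmentP x y p : x <> y ->
  relint (segment x y) p <-> exists t, [/\ 0 < t, t < 1 & p = conv t x y].
Proof.
move=> xy; split.
- case=> /segmentP[t [t0 t1 ->]] nend; exists t; split=> //.
  + rewrite lt0r t0 andbT; apply/eqP => t0'; apply: nend.
    by apply/endpoints_segment => //; rewrite t0' conv0; left.
  + rewrite lt_neqAle t1 andbT; apply/eqP => t1'; apply: nend.
    by apply/endpoints_segment => //; rewrite t1' conv1; right.
- case=> t [t0 t1 ->]; split.
    by apply/segmentP; exists t; split=> //; exact: ltW.
  move/(endpoints_segment _ xy) => -[|].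
  + by rewrite -[RHS](conv0 x y) => /(conv_inj xy) e; rewrite e ltxx in t0.
  + by rewrite -[RHS](conv1 x y) => /(conv_inj xy) e; rewrite e ltxx in t1.
Qed.

Lemma relint_sub S : relint S `<=` S.
Proof. by move=> p []. Qed.

Lemma relint_l x y : x <> y -> ~ relint (segment x y) x.
Proof. by move=> xy [_]; apply; apply/endpoints_segment => //; left. Qed.

Lemma relint_r x y : x <> y -> ~ relint (segment x y) y.
Proof. by move=> xy; rewrite segmentC; apply/relint_l/nesym. Qed.

Lemma endpoints_sub S : endpoints S `<=` S.
Proof. by move=> p [q [_ ->]]; exact: segment_l. Qed.

Lemma segment_eq x y z w : x <> y -> segment x y = segment z w ->
  (x = z /\ y = w) \/ (x = w /\ y = z).
Proof.
move=> xy e.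
have zw : z <> w by apply/is_segmentP; rewrite -e; exact/is_segmentP.
have [/endpoints_segment -/(_ zw) ex /endpoints_segment -/(_ zw) ey] :
    endpoints (segment z w) x /\ endpoints (segment z w) y.
  by rewrite -e; split; apply/endpoints_segment => //; [left|right].
by case: ex => ex; case: ey => ey; [case: xy| left | right | case: xy]; subst.
Qed.

Lemma segment_of_endpoints S p q :
  endpoints S p -> endpoints S q -> p <> q -> S = segment p q.
Proof.
move=> [r [pr ->]] /endpoints_segment -/(_ pr) [->|->] //.
Qed.

Lemma relint_conv S p q t : is_segment S -> S p -> S q -> p <> q ->
  0 < t -> t < 1 -> relint S (conv t p q).
Proof.
move=> [x [y [xy ->]]] /segmentP[s [s0 s1 ->]] /segmentP[u [u0 u1 ->]] pq t0 t1.
rewrite conv_conv; apply/relint_segmentP => //.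
have su : s <> u by move=> su; apply: pq; rewrite su.
have {su}[su|su] : s < u \/ u < s by apply/orP; rewrite -neq_lt; exact/eqP.
all: by eexists; split; [| |reflexivity]; nra.
Qed.

(** * Orientation and collinearity in the plane *)

(** The cross product of [y - x] and [p - x], that is, twice the signed area of the triangle [x],
    [y], [p]. *)
Definition orient x y p : R :=
  (y 0 0 - x 0 0) * (p 0 1 - x 0 1) - (y 0 1 - x 0 1) * (p 0 0 - x 0 0).

Definition affine (h : 'rV[R]_2 -> R) :=
  forall t x y, h (conv t x y) = (1 - t) * h x + t * h y.

Lemma orient_affine x y : affine (orient x y).
Proof. by move=> t p q; rewrite /orient !mxE; ring. Qed.

Lemma orient_rot x y z : orient y z x = orient x y z.
Proof. by rewrite /orient; ring. Qed.

Lemma orient_swap x y z : orient y x z = - orient x y z.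
Proof. by rewrite /orient; ring. Qed.

Lemma orient_l x y : orient x y x = 0.
Proof. by rewrite /orient; ring. Qed.

Lemma orient_r x y : orient x y y = 0.
Proof. by rewrite /orient; ring. Qed.

Lemma orient_conv x y t : orient x y (conv t x y) = 0.
Proof. by rewrite orient_affine orient_l orient_r; ring. Qed.

Lemma orient_eq0 x y p :
  x <> y -> orient x y p = 0 -> exists t, p = conv t x y.
Proof.
move=> xy; rewrite /orient => o0.
(* The parameter is read off from a coordinate in which [x] and [y] differ. *)
have [e0|d0] := eqVneq (y 0 0) (x 0 0).
- have d1 : y 0 1 - x 0 1 != 0.
    by rewrite subr_eq0; apply/eqP => e1; apply: xy; exact: row2P.
  exists ((p 0 1 - x 0 1) / (y 0 1 - x 0 1)); apply: row2P; rewrite !mxE.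
  + rewrite e0; have : p 0 0 - x 0 0 = 0; last by lra.
    by apply/eqP; rewrite -(mulrI_eq0 _ (lregP d1)); apply/eqP; nra.
  + by field.
- have {}d0 : y 0 0 - x 0 0 != 0 by rewrite subr_eq0.
  exists ((p 0 0 - x 0 0) / (y 0 0 - x 0 0)); apply: row2P; rewrite !mxE.
  + by field.
  + apply: (mulfI d0).
    transitivity ((y 0 0 - x 0 0) * x 0 1
                  + (y 0 1 - x 0 1) * (p 0 0 - x 0 0)); first by nra.
    by field.
Qed.

Lemma orient_collinear x y z : orient x y z != 0 -> ~ collinear x y z.
Proof.
move=> /eqP o [_ [[p [q [_ ->]]] [[t _ et] [s _ es] [u _ eu]]]]; apply: o.
by rewrite /orient -et -es -eu !mxE; ring.
Qed.

(** Coincident points are allowed, with [p] translated by (1, 1) as the second point; hence a triple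
    with a repetition is collinear. *)
Lemma line_through p q : exists L, [/\ is_line L, L p & L q].
Proof.
have line x y : x <> y -> exists L, [/\ is_line L, L x & L y].
  move=> xy; exists [set conv t x y | t in [set: R]].
  by split; [exists x, y|exists 0; rewrite ?conv0|exists 1; rewrite ?conv1].
have [<-|/eqP] := eqVneq p q; last exact: line.
have [|L [? ? _]] := line p (p + const_mx 1); last by exists L.
move=> /rowP/(_ 0); rewrite !mxE => /eqP.
by rewrite -subr_eq0 opprD addNKr oppr_eq0 oner_eq0.
Qed.

Lemma not_collinear_neq x y z :
  ~ collinear x y z -> [/\ x <> y, y <> z & z <> x].
Proof.
move=> nc; split=> e; apply: nc; rewrite e.
- by have [L [? ? ?]] := line_through y z; exists L.
- by have [L [? ? ?]] := line_through x z; exists L.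
- by have [L [? ? ?]] := line_through x y; exists L.
Qed.

End Segments.

(** * Degrees in 3-connected graphs *)

Lemma card_ge_fresh (T : choiceType) (V : set T) n (s : seq T) :
  `I_n #<= V -> (size s < n)%N -> exists2 x, V x & x \notin s.
Proof.
move=> /card_leP/unsquash f sn; apply/not_exists2P => Vs.
pose g (i : 'I_n) := val (f (SigSub (mem_set (ltn_ord i : `I_n i)))).
have : (size (map g (enum 'I_n)) <= size s)%N.
  apply: uniq_leq_size => [|_ /mapP[i _ ->]].
    rewrite map_inj_uniq ?enum_uniq // => i j /val_inj e; apply: val_inj.
    by have /(congr1 val) := @inj _ _ _ f _ _ (mem_set I) (mem_set I) e.
  have Vg : V (g i) by apply: set_mem; exact: valP.
  by have [|/negP/negbNE] := Vs (g i).
by rewrite size_map size_enum_ord leqNgt sn.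
Qed.

(** Delete two vertices and follow a path from [v] to another surviving vertex: its first step gives
    the neighbour. *)
Lemma three_connected_degree (T : choiceType) (V : set T) (E : T -> T -> Prop) v :
  three_connected V E -> (forall x, ~ E x x) -> V v ->
  forall y z, exists u, [/\ V u, E v u, u <> y & u <> z].
Proof.
move=> [V4 conn] irr Vv y z.
(* Connectivity is assumed only after deleting two distinct vertices, and [v] has to survive. So [y]
   and [z] are replaced by distinct vertices [y'] and [z'] other than [v], chosen so that a
   neighbour of [v] avoiding these avoids [y] and [z] too. *)
have other w w' : exists r, [/\ V r, r <> v, r <> w'
    & V w -> w <> v -> w = r \/ w = w'].
  have [|r Vr] := @card_ge_fresh _ _ _ [:: v; w'] V4; first by [].
  rewrite !inE negb_or => /andP[/eqP rv /eqP rw'].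
  have [[Vw wv ww']|nw] := pselect [/\ V w, w <> v & w <> w'].
    by exists w; split; auto.
  exists r; split=> // Vw wv; right; apply/eqP/negPn/negP => /eqP ww'.
  by apply: nw.
have [y' [Vy' y'v _ yy']] := other y v.
have [z' [Vz' z'v z'y' zz']] := other z y'.
have [|x Vx] := @card_ge_fresh _ _ _ [:: v; y'; z'] V4; first by [].
rewrite !inE !negb_or => /and3P[/eqP xv /eqP xy' /eqP xz'].
have Dv : (V `\` [set y'; z']) v by split=> // -[/esym|/esym].
have Dx : (V `\` [set y'; z']) x by split=> // -[].
have /clos_rt_rt1n_iff path := conn y' z' Vy' Vz' (nesym z'y') v x Dv Dx.
move: xv; case: path => // u w.
move=> [_ [Vu uyz] Evu] _ _; exists u.
have uv : u <> v by move=> uv; move: Evu; rewrite uv; exact: irr.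
split=> // e; subst; apply: uyz.
- by case: (yy' Vu uv) => [|/uv //]; left.
- by case: (zz' Vu uv) => ?; [right|left].
Qed.

(** * Segments with disjoint relative interiors, and their corners *)

Section SegmentSystem.
Variables (R : realType) (F : set (set 'rV[R]_2)).
Hypotheses (F_segments : forall S, F S -> is_segment S)
           (F_disjoint : trivIset F (@relint R)).
Implicit Types (x y z w p q v : 'rV[R]_2) (s t u : R) (S T : set 'rV[R]_2).

Lemma F_neq x y : F (segment x y) -> x <> y.
Proof. by move=> /F_segments /is_segmentP. Qed.

Lemma relint_eq S T p : F S -> F T -> relint S p -> relint T p -> S = T.
Proof. by move=> FS FT Sp Tp; apply: F_disjoint => //; exists p. Qed.

(** The midpoint of [p] and [q] lies in both relative interiors. *)
Lemma two_points_eq S T p q : F S -> F T -> p <> q ->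
  S p -> S q -> T p -> T q -> S = T.
Proof.
move=> FS FT pq Sp Sq Tp Tq; have lt2 : 0 < 2^-1 :> R by lra.
have ge2 : 2^-1 < 1 :> R by lra.
by apply: (@relint_eq _ _ (conv 2^-1 p q)) => //; apply: relint_conv => //;
  exact: F_segments.
Qed.

Lemma shared_endpoint p q r :
  F (segment p q) -> F (segment p r) -> segment p r q -> q = r.
Proof.
move=> Fq Fr rq; have pq := F_neq Fq; have pr := F_neq Fr.
have /(segment_eq pq)[[]//|[? e]] : segment p q = segment p r; last by case: pq.
apply: (two_points_eq _ _ pq) => //; do ?exact: segment_l; exact: segment_r.
Qed.

Lemma shared_endpoint_relint p q r :
  F (segment p q) -> F (segment p r) -> ~ relint (segment p r) q.
Proof.
move=> Fq Fr rq; have /= qr := shared_endpoint Fq Fr (relint_sub rq).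
by move: rq; rewrite qr; exact/relint_r/F_neq.
Qed.

(** Both segments would contain [x'] and [y'], hence coincide, and then an end would lie in the
    relative interior. *)
Lemma mutual_relint x x' y y' : F (segment x x') -> F (segment y y') ->
  relint (segment x x') y' -> ~ relint (segment y y') x'.
Proof.
move=> Fx Fy xy yx; have xx' := F_neq Fx; have yy' := F_neq Fy.
have y'x' : y' <> x' by move=> e; move: xy; rewrite e; exact: relint_r.
have e : segment x x' = segment y y'.
  apply: (two_points_eq _ _ y'x') => //;
    do ?exact: segment_r; exact: relint_sub.
by move: xy; rewrite e; exact: relint_r.
Qed.

Lemma vertex_l x y : F (segment x y) -> vertices F x.
Proof. by move=> Fxy; exists (segment x y) => //; exists y; split=> //; exact: F_neq. Qed.

Lemma vertex_r x y : F (segment x y) -> vertices F y.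
Proof. by rewrite segmentC; exact: vertex_l. Qed.

Definition corner v := vertices F v /\ forall S, F S -> ~ relint S v.

Lemma corner_endpoint v S : corner v -> F S -> S v -> endpoints S v.
Proof. by move=> [_ nv] FS Sv; apply: contrapT => ?; exact: (nv S FS). Qed.

(** The vertex at parameter [t] lies strictly between [v] and the point at parameter [s], at
    relative parameter [t / s]. *)
Lemma not_adjacent_conv v w t s : 0 <= t -> t < s -> v <> w ->
  vertices F (conv t v w) -> v <> conv t v w -> ~ adjacent F v (conv s v w).
Proof.
move=> t0 ts vw Vt vt [vs _]; rewrite -subset0 => /(_ (conv t v w)); apply.
split=> //; apply/(relint_segmentP _ vs).
have {vt}t0' : 0 < t.
  by rewrite lt0r t0 andbT; apply/eqP => t0'; apply: vt; rewrite t0' conv0.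
have s0 : 0 < s by exact: lt_trans ts.
exists (t / s); split; [exact: divr_gt0|by rewrite ltr_pdivrMr ?mul1r|].
by rewrite -[X in conv (t / s) X _](conv0 v w) conv_conv;
          congr (conv _ _ _); field; rewrite gt_eqF.
Qed.

(* Two neighbours of v on one segment ending at v would give two nested
   vertex-free open segments, so distinct neighbours lie on distinct segments. *)
Lemma corner_degree v y z : three_connected (vertices F) (adjacent F) ->
  corner v -> exists x, [/\ F (segment v x), x <> y & x <> z].
Proof.
move=> F3 cv; have deg := three_connected_degree F3 _ (proj1 cv).
have nbr w : exists w', forall p, vertices F p -> adjacent F v p ->
    v <> w -> segment v w p -> p = w'.
  have [[w' [Vw' Evw' ww']]|nw] := pselect (exists w', [/\ vertices F w',
      adjacent F v w' & segment v w w']); last first.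
    by exists v => p Vp Evp vw wu; case: nw; exists p.
  exists w' => p Vp Evp vw; move: (ww') => /segmentP[t [t0 t1 e]].
  move=> /segmentP[s [s0 s1 e']]; apply: contrapT => pw'.
  have st : s <> t by move=> st; apply: pw'; rewrite e e' st.
  have {st}[st|st] : s < t \/ t < s by apply/orP; rewrite -neq_lt; exact/eqP.
  - by apply: (not_adjacent_conv _ st vw); rewrite -?e -?e' //; case: Evp.
  - by apply: (not_adjacent_conv _ st vw); rewrite -?e -?e' //; case: Evw'.
have [y' y'P] := nbr y; have [z' z'P] := nbr z.
have [|p [Vp Evp py' pz']] := deg _ y' z'; first by move=> x [].
have [_ [S [FS Sv Sp]] _] := Evp.
have [x [vx Sx]] := corner_endpoint cv FS Sv.
exists x; split; first by rewrite -Sx.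
- by move=> xy; apply: py'; apply: y'P => //; rewrite -xy -?Sx.
- by move=> xz; apply: pz'; apply: z'P => //; rewrite -xz -?Sx.
Qed.

(** * Corners as extreme points of affine functionals *)

Lemma enum_system n : F #= `I_n ->
  exists f : 'I_n -> set 'rV[R]_2, injective f /\ F = range f.
Proof.
rewrite card_eq_sym => /card_set_bijP[f [fF finj fsurj]].
exists (fun i => f (val i)); split=> [i j e|].
  by apply/val_inj/finj => //; rewrite inE /=.
apply/seteqP; split=> [S /fsurj[i /= ilt <-]|_ [i _ <-]].
- by exists (Ordinal ilt).
- by apply: fF => /=.
Qed.

(* Ties for the maximum of [h] are broken by the strictly convex function
   |p|^2, whose maximum on a segment is never attained in the interior. *)
Lemma corner_above n h v : F #= `I_n -> affine h -> vertices F v ->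
  exists2 w, corner w & h v <= h w.
Proof.
move=> /enum_system[f [_ Ff]] hA Vv.
have ends i : exists xy : 'rV[R]_2 * 'rV[R]_2,
    xy.1 <> xy.2 /\ f i = segment xy.1 xy.2.
  by have [|x [y ?]] := F_segments (_ : F (f i)); [rewrite Ff; exists i|exists (x, y)].
have [g gP] := choice ends.
(* Indexing the segment ends by a finite type, with repetitions, makes maxima over the vertices
   available. *)
pose pt (k : 'I_n * bool) := if k.2 then (g k.1).1 else (g k.1).2.
have ptV k : vertices F (pt k).
  exists (f k.1); first by rewrite Ff; exists k.1.
  have [ne ->] := gP k.1; apply/endpoints_segment => //.
  by rewrite /pt; case: k.2; auto.
have Vpt p : vertices F p -> exists k, p = pt k.
  move=> [S]; rewrite Ff => -[i _ <-]; have [ne ->] := gP i.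
  move=> /endpoints_segment -/(_ ne)[] ->; [exists (i, true)|exists (i, false)] => //.
have [k0 vk0] := Vpt _ Vv.
case: (@arg_maxP _ _ _ k0 predT (h \o pt) isT) => k1 _ k1P.
pose sq p : R := p 0 0 * p 0 0 + p 0 1 * p 0 1.
case: (@arg_maxP _ _ _ k1 [pred k | h (pt k) == h (pt k1)] (sq \o pt) (eqxx _)).
move=> k2 /= /eqP ek2 k2P; exists (pt k2); last by rewrite vk0 ek2; exact: k1P.
split=> [|S FS]; first exact: ptV.
have [x [y [xy eS]]] := F_segments FS; rewrite {}eS in FS *.
move=> /relint_segmentP -/(_ xy)[t [t0 t1 ek]].
have [kx ekx] := Vpt _ (vertex_l FS); have [ky eky] := Vpt _ (vertex_r FS).
have /= hx := k1P kx isT; have /= hy := k1P ky isT.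
(* At an interior point [h] is a proper average of its values at the two ends, which do not exceed
   the maximum; so both ends attain it and take part in the tie-break. *)
have hk : h (pt k1) = (1 - t) * h x + t * h y by rewrite -ek2 ek hA.
rewrite -ekx in hx; rewrite -eky in hy.
have ex : h x = h (pt k1) by nra.
have ey : h y = h (pt k1) by nra.
have := k2P kx; rewrite -ekx ex => /(_ (eqxx _)) /= sx.
have := k2P ky; rewrite -eky ey => /(_ (eqxx _)) /= sy.
(* Strict convexity in explicit form: the defect is [t * (1 - t)] times the squared length of the
   segment, so maximality of [sq] at [pt k2] forces [x = y]. *)
have sk : sq (pt k2) = (1 - t) * sq x + t * sq y
    - t * (1 - t) * ((x 0 0 - y 0 0) ^+ 2 + (x 0 1 - y 0 1) ^+ 2).
  by rewrite ek /sq !mxE; ring.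
have tt : 0 < t * (1 - t) by apply: mulr_gt0; lra.
have d0 : (x 0 0 - y 0 0) ^+ 2 + (x 0 1 - y 0 1) ^+ 2 <= 0.
  rewrite -(pmulr_rle0 _ tt).
  have : (1 - t) * sq x <= (1 - t) * sq (pt k2) by apply: ler_wpM2l => //; lra.
  have : t * sq y <= t * sq (pt k2) by apply: ler_wpM2l => //; lra.
  lra.
have sq0 := sqr_ge0 (x 0 0 - y 0 0); have sq1 := sqr_ge0 (x 0 1 - y 0 1).
apply: xy; apply: row2P; apply/eqP; rewrite -subr_eq0 -sqrf_eq0; apply/eqP; lra.
Qed.

(** The condition [0 < t * s] puts both ends on the same side of [a]; the nearer end then lies on
    the other segment, and [shared_endpoint] applies. *)
Lemma same_ray a b x y t s : F (segment a x) -> F (segment a y) ->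
  x = conv t a b -> y = conv s a b -> 0 < t * s -> x = y.
Proof.
wlog ts : x y t s / t / s <= 1.
  move=> th Fx Fy ex ey ts0; have [le1|gt1] := leP (t / s) 1.
    exact: (th x y t s).
  apply/esym; apply: (th y x s t) => //; last by rewrite mulrC.
  by rewrite -[_ / _]invf_div invf_le1 ?ltW// (lt_trans _ gt1).
move=> Fx Fy ex ey ts0; apply: (shared_endpoint Fx Fy); apply/segmentP.
have s0 : s != 0 by apply: contraTneq ts0 => ->; rewrite mulr0 ltxx.
exists (t / s); split=> //.
- have -> : t / s = t * s / s ^+ 2 by field.
  by rewrite divr_ge0 ?ltW// exprn_even_gt0.
- rewrite ey -[X in conv (t / s) X _](conv0 a b) conv_conv ex.
  by congr (conv _ _ _); field.
Qed.

Lemma affineN h : affine h -> affine (fun p => - h p).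
Proof. by move=> hA t x y; rewrite hA; ring. Qed.

(** Three segments end at [a], but a line has only two rays from [a]; were all vertices on the line,
    two of the segments would share a ray. *)
Lemma corner_not_flat a b : three_connected (vertices F) (adjacent F) ->
  corner a -> a <> b -> exists2 v, vertices F v & orient a b v <> 0.
Proof.
move=> F3 ca ab; apply: contrapT => /forall2NP flat.
have ray x : F (segment a x) -> exists2 t, t != 0 & x = conv t a b.
  move=> Fx; have [//|/contrapT /(orient_eq0 ab)[t ex]] := flat x.
    by move=> nV; case: nV; exact: vertex_r Fx.
  exists t => //; apply/eqP => t0; apply: (F_neq Fx).
  by rewrite ex t0 conv0.
have [x [Fx _ _]] := corner_degree a a F3 ca.
have [y [Fy yx _]] := corner_degree x x F3 ca.
have [z [Fz zx zy]] := corner_degree x y F3 ca.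
have [t t0 ex] := ray _ Fx; have [s s0 ey] := ray _ Fy.
have [u u0 ez] := ray _ Fz.
(* Two of three nonzero parameters have the same sign: the product of their pairwise products is a
   nonzero square. *)
have : [|| 0 < t * s, 0 < t * u | 0 < s * u].
  rewrite !ltNge -!negb_and; apply/negP => /and3P[ts tu su].
  have : 0 < t * s * (t * u * (s * u)).
    have -> : t * s * (t * u * (s * u)) = (t * s * u) ^+ 2 by ring.
    by rewrite exprn_even_gt0 // !mulf_neq0.
  by rewrite ltNge mulr_le0_ge0 // mulr_le0.
move=> /or3P[/(same_ray Fx Fy ex ey)|/(same_ray Fx Fz ex ez)
  |/(same_ray Fy Fz ey ez)] //; exact: nesym.
Qed.

(** Going up and down along a segment of [F] yields two distinct corners [a] and [b]. If every
    corner lay on their line, so would every vertex, since corners bound both [orient a b] and its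
    negative; this contradicts [corner_not_flat]. *)
Lemma noncollinear_corners n : F #= `I_n ->
  three_connected (vertices F) (adjacent F) ->
  exists a b c, [/\ corner a, corner b, corner c & 0 < orient a b c].
Proof.
move=> Fn F3; have [F4 _] := F3.
have [v [S FS _] _] := card_ge_fresh (F4 : `I_4 #<= _) (isT : (size [::] < 4)%N).
have [p [q [pq eS]]] := F_segments FS; rewrite {}eS in FS.
(* The inner product with [q - p], so that [h q - h p] is the squared length of the segment. *)
pose h x := (q 0 0 - p 0 0) * x 0 0 + (q 0 1 - p 0 1) * x 0 1.
have hA : affine h by move=> t x y; rewrite /h !mxE; ring.
have hpq : h p < h q.
  rewrite -subr_gt0; have -> : h q - h p =
      (q 0 0 - p 0 0) ^+ 2 + (q 0 1 - p 0 1) ^+ 2 by rewrite /h; ring.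
  rewrite lt0r addr_ge0 ?sqr_ge0// andbT paddr_eq0 ?sqr_ge0// !sqrf_eq0 !subr_eq0.
  by apply/negP => /andP[/eqP e0 /eqP e1]; apply: pq; exact/esym/row2P.
have [b cb hb] := corner_above Fn hA (vertex_r FS).
have [a ca ha] := corner_above Fn (affineN hA) (vertex_l FS).
have ab : a <> b.
  by move=> ab; move: hb ha; rewrite ab => hb; rewrite lerN2 => /(le_trans hb);
    rewrite leNgt hpq.
apply: contrapT => nex.
have flat c : corner c -> orient a b c = 0.
  move=> cc; apply/eqP/negPn/negP; rewrite neq_lt => /orP[neg|pos].
  - by apply: nex; exists b, a, c; split=> //; rewrite orient_swap oppr_gt0.
  - by apply: nex; exists a, b, c.
have [x Vx] := corner_not_flat F3 ca ab; apply; apply/eqP; rewrite eq_le.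
have [w cw] := corner_above Fn (orient_affine a b) Vx.
have [w' cw'] := corner_above Fn (affineN (orient_affine a b)) Vx.
by rewrite lerN2 (flat w cw) (flat w' cw') => -> ->.
Qed.

(** * Sides of the triangle of corners *)

Lemma card_pair (T : Type) (x y : T) : x <> y -> [set x; y] #= `I_2.
Proof.
elim/Ppointed: T => T in x y *; first by case: (no x).
move=> xy; rewrite card_eq_sym; apply/card_set_bijP.
exists (fun n => if n is 0%N then x else y); split=> [[|[|n]] //= _|i j|_ [] ->].
- by left.
- by right.
- by rewrite !inE; case: i j => [|[|i]] [|[|j]] //= _ _ e; case: xy.
- by exists 0%N.
- by exists 1%N.
Qed.

(** The line through [a] and [b] meets the union in a third point [p], which is not a corner and so
    lies inside a segment. As all vertices are on one side, that segment runs along the line, and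
    its ends can only be [a] and [b]. *)
Lemma corner_side a b : corner a -> corner b -> a <> b ->
  (forall L, is_line L -> ~ (L `&` \bigcup_(S in F) S #= `I_2)) ->
  (forall v, vertices F v -> 0 <= orient a b v) ->
  (forall v, corner v -> orient a b v = 0 -> v = a \/ v = b) ->
  F (segment a b).
Proof.
move=> ca cb ab lines pos cor.
have Vin v : vertices F v -> (\bigcup_(S in F) S) v.
  by move=> [S FS Sv]; exists S => //; exact: endpoints_sub.
pose L : set 'rV[R]_2 := [set conv t a b | t in [set: R]].
have Lline : is_line L by exists a, b.
have [p [Lp [S FS Sp] pa pb]] : exists p,
    [/\ L p, (\bigcup_(S in F) S) p, p <> a & p <> b].
  apply: contrapT => nex; apply: (lines L Lline).
  rewrite (_ : _ `&` _ = [set a; b]); first exact: card_pair.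
  apply/seteqP; split=> [p [Lp Up]|p [->|->]].
  - apply: contrapT => /not_orP[pa pb].
    by apply: nex; exists p.
  - split; last by apply: Vin; case: ca.
    by exists 0 => //; rewrite conv0.
  - split; last by apply: Vin; case: cb.
    by exists 1 => //; rewrite conv1.
have {Lp} op : orient a b p = 0 by case: Lp => t _ <-; exact: orient_conv.
(* A proper average of two nonnegative values vanishes only if both do. *)
have split_edge x y q : F (segment x y) -> relint (segment x y) q ->
    orient a b q = 0 -> orient a b x = 0 /\ orient a b y = 0.
  move=> Fxy /(relint_segmentP _ (F_neq Fxy))[t [t0 t1 ->]].
  rewrite orient_affine; have := pos _ (vertex_l Fxy); have := pos _ (vertex_r Fxy).
  by move=> ? ?; split; nra.
have {S FS Sp} [x [y [Fxy pxy]]] :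
    exists x y, F (segment x y) /\ relint (segment x y) p.
  have [[T [FT Tp]]|nT] := pselect (exists T, F T /\ relint T p).
    by have [x [y [_ eT]]] := F_segments FT; exists x, y; rewrite -eT.
  have nr T : F T -> ~ relint T p by move=> FT Tp; apply: nT; exists T.
  have cp : corner p.
    split=> //; exists S => //; apply: contrapT => nSp.
    exact: (nr S FS).
  by case: (cor p cp op).
have [ox oy] := split_edge _ _ _ Fxy pxy op.
(* An end of xy other than a, b would lie inside a segment along the same line,
   which would overlap xy. *)
have end_corner z w : F (segment z w) -> orient a b z = 0 -> orient a b w = 0 ->
    z = a \/ z = b.
  move=> Fzw oz ow; apply: contrapT => zab.
  have [T [FT Tz]] : exists T, F T /\ relint T z.
    apply: contrapT => nT; apply: zab; apply: cor => //.
    by split=> [|T FT Tz]; [exact: vertex_l Fzw|apply: nT; exists T].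
  have [x' [y' [xy' eT]]] := F_segments FT; rewrite {}eT in FT Tz.
  have [ox' oy'] := split_edge _ _ _ FT Tz oz.
  have zw := F_neq Fzw.
  move: (Tz) => /(relint_segmentP _ xy')[t [t0 t1 ez]].
  have [tx ex] := orient_eq0 ab ox'; have [ty ey] := orient_eq0 ab oy'.
  have [tw ew] := orient_eq0 ab ow.
  have txy : ty - tx != 0.
    by rewrite subr_eq0; apply/eqP => e; apply: xy'; rewrite ex ey e.
  have [r er] : exists r, w = conv r x' y'.
    exists ((tw - tx) / (ty - tx)); rewrite ex ey conv_conv ew.
    by congr (conv _ _ _); field.
  (* The second common point is found by going from [z] towards [w]: it is the end of the other
     segment passed on the way, or [w] itself if none is passed. *)
  have [q [zq qzw qxy]] : exists q,
      [/\ z <> q, segment z w q & segment x' y' q].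
    have [r0|r0] := ltP r 0; last have [r1|r1] := ltP 1 r.
    - exists x'; split; last exact: segment_l.
        by move=> e; move: Tz; rewrite e; exact: relint_l.
      have tr0 : 0 < t - r by rewrite subr_gt0 (lt_trans r0).
      apply/segmentP; exists (t / (t - r)); split.
      + by rewrite divr_ge0 ?ltW.
      + by rewrite ler_pdivrMr // mul1r lerBrDr gerDl ltW.
      + by rewrite ez er conv_conv -[LHS](conv0 x' y');
          congr (conv _ _ _); field; rewrite gt_eqF.
    - exists y'; split; last exact: segment_r.
        by move=> e; move: Tz; rewrite e; exact: relint_r.
      have rt0 : 0 < r - t by rewrite subr_gt0 (lt_trans t1).
      apply/segmentP; exists ((1 - t) / (r - t)); split.
      + by rewrite divr_ge0 ?subr_ge0 ?ltW // -subr_gt0.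
      + by rewrite ler_pdivrMr // mul1r lerD2r ltW.
      + by rewrite ez er conv_conv -[LHS](conv1 x' y');
          congr (conv _ _ _); field; rewrite gt_eqF.
    - by exists w; split; [|exact: segment_r|apply/segmentP; exists r].
  have e : segment z w = segment x' y'.
    by apply: (two_points_eq _ _ zq) => //; [exact: segment_l|exact: relint_sub].
  by move: Tz; rewrite -e; exact: relint_l.
have xy := F_neq Fxy.
have xab := end_corner _ _ Fxy ox oy.
have yab : y = a \/ y = b by apply: (end_corner y x) => //; rewrite segmentC.
case: xab yab => ? [] ?; subst => //; by rewrite segmentC.
Qed.

(** * Families with four corners and with three *)

Lemma six_setP (T : Type) (s1 s2 s3 s4 s5 s6 x : T) :
  [set s1; s2; s3; s4; s5; s6] x <->
  x = s1 \/ x = s2 \/ x = s3 \/ x = s4 \/ x = s5 \/ x = s6.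
Proof. by rewrite /setU /set1 /mkset /=; tauto. Qed.

Lemma card_exhaust n (s : seq (set 'rV[R]_2)) S : F #= `I_n -> size s = n ->
  uniq s -> (forall T, T \in s -> F T) -> F S -> S \in s.
Proof.
move=> /enum_system[f [finj ->]] sn us sF [i _ <-].
have sub : {subset s <= map f (enum 'I_n)}.
  by move=> T /sF[j _ <-]; rewrite map_f // mem_enum.
have [|_ ->] := uniq_min_size us sub; last by rewrite map_f // mem_enum.
by rewrite size_map size_enum_ord sn.
Qed.

Lemma sum_nat_bool_card (T : finType) (p : pred T) :
  (\sum_i p i)%N = #|[pred i | p i]|.
Proof. by rewrite -sum1_card [RHS]big_mkcond; apply: eq_bigr => i _; rewrite inE; case: (p i). Qed.

(* The 12 segment ends cover each of the four corners three times, so nothing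
   is left for other vertices. *)
Lemma four_corners_complete (P : 'I_4 -> 'rV[R]_2) : injective P ->
  (forall k, corner (P k)) -> F #= `I_6 ->
  three_connected (vertices F) (adjacent F) ->
  forall S, F S -> exists k l, k <> l /\ S = segment (P k) (P l).
Proof.
move=> Pinj Pc /enum_system[f [finj Ff]] F3.
have Ff' i : F (f i) by rewrite Ff; exists i.
(* The incidence matrix of corners and segments: the sum over a corner is at least 3, the sum over a
   segment at most 2, and the total is computed in both orders. *)
pose inc k i : bool := `[< endpoints (f i) (P k) >].
have incP k i : reflect (endpoints (f i) (P k)) (inc k i) by exact: asboolP.
have index k x : F (segment (P k) x) ->
    exists2 i, f i = segment (P k) x & inc k i.
  move=> Fx; have [i _ e] : range f (segment (P k) x) by rewrite -Ff.
  exists i => //; apply/incP; rewrite e; apply/endpoints_segment; last by left.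
  exact: F_neq.
have row k : (3 <= \sum_(i < 6) inc k i)%N.
  have [x [Fx _ _]] := corner_degree (P k) (P k) F3 (Pc k).
  have [y [Fy yx _]] := corner_degree x x F3 (Pc k).
  have [z [Fz zx zy]] := corner_degree x y F3 (Pc k).
  have [i ei ik] := index _ _ Fx; have [j ej jk] := index _ _ Fy.
  have [l el lk] := index _ _ Fz.
  have neq m n p q : f m = segment (P k) p -> f n = segment (P k) q ->
      F (segment (P k) p) -> F (segment (P k) q) -> p <> q -> m != n.
    move=> em en Fp Fq pq; apply/eqP => mn; apply: pq.
    by apply: (shared_endpoint Fp Fq); rewrite -en -mn em; exact: segment_r.
  rewrite sum_nat_bool_card; apply/card_gt2P; exists i, j, l; split; split=> //.
  - exact: neq ei ej Fx Fy (nesym yx).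
  - exact: neq ej el Fy Fz (nesym zy).
  - exact: neq el ei Fz Fx zx.
have col i : (\sum_(k < 4) inc k i <= 2)%N.
  rewrite sum_nat_bool_card leqNgt; apply/negP => /card_gt2P[k [l [m [[]]]]].
  rewrite !inE => ki li mi [/eqP kl /eqP lm /eqP mk].
  have [x [y [xy e]]] := F_segments (Ff' i).
  move: ki li mi; rewrite e => /(endpoints_segment _ xy) ki.
  move=> /(endpoints_segment _ xy) li /(endpoints_segment _ xy) mi.
  by case: ki li mi => k1 [] l1 [] m1; (case: kl + case: lm + case: mk);
    apply: Pinj; congruence.
have total : (12 <= \sum_(i < 6) \sum_(k < 4) inc k i)%N.
  rewrite exchange_big /=; apply: (@leq_trans (\sum_(k < 4) 3)).
    by rewrite sum_nat_const card_ord.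
  by apply: leq_sum => k _.
have full i : exists k l, k <> l /\ f i = segment (P k) (P l).
  (* A segment with at most one corner as an end would leave at most 1 + 5 * 2 = 11 incidences,
     short of 12. *)
  have : (1 < \sum_(k < 4) inc k i)%N.
    rewrite ltnNge; apply/negP => le1; move: total; apply/negP; rewrite -ltnNge.
    rewrite (bigD1 i) //= ltnS; apply: (@leq_trans (1 + \sum_(j < 6 | j != i) 2)).
      by apply: leq_add => //; apply: leq_sum => j _; exact: col.
    by rewrite sum_nat_const cardC1 card_ord.
  rewrite sum_nat_bool_card => /card_gt1P[k [l []]].
  rewrite !inE => ki li /eqP kl.
  exists k, l; split=> //; apply: segment_of_endpoints => //.
  by move=> /Pinj.
by move=> S; rewrite Ff => -[i _ <-].
Qed.

(** All ends are among the four corners, and each corner has a segment whose other end avoids any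
    two given points; so it is joined to each of the other three. *)
Lemma four_corners a b c d : [/\ corner a, corner b, corner c & corner d] ->
  uniq [:: a; b; c; d] -> F #= `I_6 ->
  three_connected (vertices F) (adjacent F) ->
  F = [set segment a b; segment b c; segment c a;
           segment a d; segment b d; segment c d].
Proof.
move=> [ca cb cc cd] abcd F6 F3.
pose P (k : 'I_4) := nth a [:: a; b; c; d] k.
have Pinj : injective P.
  by move=> k l /eqP; rewrite nth_uniq // => /eqP /val_inj.
have Pc k : corner (P k) by case: k => [[|[|[|[|]]]]].
have FP := four_corners_complete Pinj Pc F6 F3.
have mem x y : F (segment x y) -> y \in [:: a; b; c; d].
  move=> Fxy; have [k [l [_ e]]] := FP _ Fxy.
  have Pmem j : P j \in [:: a; b; c; d] by exact: mem_nth.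
  by case: (segment_eq (F_neq Fxy) e) => -[_ ->].
have edge k l m n : corner k -> {subset [:: a; b; c; d] <= [:: k; l; m; n]} ->
    F (segment k l).
  move=> ck sub; have [x [Fx xm xn]] := corner_degree m n F3 ck.
  have := sub x (mem _ _ Fx); rewrite !inE => /or4P[] /eqP // ex.
  - by case: (F_neq Fx).
  - by rewrite -ex.
apply/seteqP; split=> [S /FP[k [l [kl ->]]]|S /six_setP].
- set six := (X in X _).
  have sixC x y : six (segment x y) -> six (segment y x) by rewrite segmentC.
  have kl' : P k <> P l by move=> /Pinj.
  move: kl'; rewrite /P; case: k l {kl} => [[|[|[|[|//]]]] ?] [[|[|[|[|//]]]] ?] /= xy;
    first [by case: xy | by apply/six_setP; tauto
          | by apply: sixC; apply/six_setP; tauto].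
- have ps x y z w : [:: x; y; z; w] =i [:: a; b; c; d] -> corner x -> F (segment x y).
    by move=> e cx; apply: (edge x y z w) => // p; rewrite e.
  by do 5?[case=> [->|]]; last move=> ->;
    [apply: (ps _ _ c d)|apply: (ps _ _ a d)|apply: (ps _ _ b d)
    |apply: (ps _ _ b c)|apply: (ps _ _ a c)|apply: (ps _ _ a b)];
    rewrite // => p; rewrite !inE; do !case: eqP.
Qed.

(** The sides come from [corner_side]. At each corner a further segment ends; its other end is none
    of [a], [b], [c], hence no corner. These six segments are distinct and so exhaust [F]. *)
Lemma three_corners a b c : [/\ corner a, corner b & corner c] ->
  0 < orient a b c -> (forall v, corner v -> [\/ v = a, v = b | v = c]) ->
  F #= `I_6 -> three_connected (vertices F) (adjacent F) ->
  (forall L, is_line L -> ~ (L `&` \bigcup_(S in F) S #= `I_2)) ->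
  exists a' b' c', [/\ F = [set segment a b; segment b c; segment c a;
                                segment a a'; segment b b'; segment c c'],
    ~ corner a', ~ corner b' & ~ corner c'].
Proof.
move=> [ca cb cc] o cor F6 F3 lines.
have [ab bc ac] : [/\ a <> b, b <> c & a <> c].
  split=> e; move: o; rewrite e ?orient_l ?orient_r ?ltxx //.
  by rewrite -orient_rot orient_l ltxx.
have pos x y z : corner x -> corner y -> corner z -> 0 < orient x y z ->
    (forall v, corner v -> [\/ v = x, v = y | v = z]) -> F (segment x y).
  move=> cx cy cz oxyz xyz; have xy : x <> y.
    by move=> e; move: oxyz; rewrite e /orient; lra.
  apply: corner_side => // v.
  (* On the vertices [orient x y] is bounded below by its values at corners, which are 0, 0 and a
     positive number. *)
  - have nA := affineN (orient_affine x y).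
    move=> /(corner_above F6 nA)[w cw]; rewrite lerN2; apply: le_trans.
    by case: (xyz w cw) => ->; rewrite ?orient_l ?orient_r // ltW.
  - move=> /xyz[->|->|->]; [by left|by right|].
    by move=> e; rewrite e ltxx in oxyz.
have Fab : F (segment a b) by exact: (pos a b c).
have Fbc : F (segment b c).
  apply: (pos b c a) => //; first by rewrite orient_rot.
  by move=> v /cor[->|->|->]; [apply: Or33|apply: Or31|apply: Or32].
have Fca : F (segment c a).
  apply: (pos c a b) => //; first by rewrite -orient_rot.
  by move=> v /cor[->|->|->]; [apply: Or32|apply: Or33|apply: Or31].
have [a' [Fa a'b a'c]] := corner_degree b c F3 ca.
have [b' [Fb b'a b'c]] := corner_degree a c F3 cb.
have [c' [Fc c'a c'b]] := corner_degree a b F3 cc.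
have aa' := F_neq Fa; have bb' := F_neq Fb; have cc' := F_neq Fc.
exists a', b', c'; split; do ?by case/cor; congruence.
pose s := [:: segment a b; segment b c; segment c a;
             segment a a'; segment b b'; segment c c'].
have neq x y z w : x <> y -> ~ ((x = z /\ y = w) \/ (x = w /\ y = z)) ->
    segment x y <> segment z w.
  by move=> xy n /(segment_eq xy).
have us : uniq s.
  rewrite !cons_uniq !in_cons !in_nil !orbF !negb_or.
  by repeat match goal with |- is_true (_ && _) => apply/andP; split end => //;
    case: pselect => // e; exfalso; move: e;
    apply: neq => [|[[? ?]|[? ?]]]; congruence.
have sF T : T \in s -> F T.
  by rewrite !in_cons in_nil orbF => /or4P[||/eqP ->|/or3P[]]; do ?[move/eqP->].
apply/seteqP; split=> [S /(card_exhaust F6 (erefl : size s = 6) us sF)|S /six_setP].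
- rewrite !in_cons in_nil orbF => S6; apply/six_setP.
  by move: S6; do 5?[case/orP=> [/eqP ->|]]; last move/eqP->; tauto.
- by do 5?[case=> [->|]] => //; move->.
Qed.


(** * Triangles with three attached segments *)

Definition star a b c a' b' c' : Prop :=
  ~ collinear a b c /\
  F = [set segment a b; segment b c; segment c a;
           segment a a'; segment b b'; segment c c'].

Definition classified tau : Prop := exists a b c a' b' c',
  star a b c a' b' c' /\ of_type tau a b c a' b' c'.

Section Star.
Variables a b c a' b' c' : 'rV[R]_2.
Hypothesis abc : star a b c a' b' c'.

(** Together with [star_swap] this generates all relabelings, so the lemmas below treat one position
    of the letters only. *)
Lemma star_rot : star b c a b' c' a'.
Proof.
have [nc e] := abc; rewrite /star e; split; first by move=> [L [lL [? ? ?]]]; apply: nc; exists L.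
by apply/seteqP; split=> S /six_setP ?; apply/six_setP; tauto.
Qed.

Lemma star_swap : star b a c b' a' c'.
Proof.
have [nc e] := abc; rewrite /star e; split; first by move=> [L [lL [? ? ?]]]; apply: nc; exists L.
rewrite (segmentC b a) (segmentC a c) (segmentC c b).
by apply/seteqP; split=> S /six_setP ?; apply/six_setP; tauto.
Qed.

Lemma star_edges : [/\ F (segment a b), F (segment b c) & F (segment c a)] /\
  [/\ F (segment a a'), F (segment b b') & F (segment c c')].
Proof. by have [_ ->] := abc; do !split; apply/six_setP; tauto. Qed.

Lemma star_neq : [/\ a <> b, b <> c & c <> a].
Proof. by have [/not_collinear_neq] := abc. Qed.

Lemma star_cases S : F S ->
  S = segment a b \/ S = segment b c \/ S = segment c a \/
  S = segment a a' \/ S = segment b b' \/ S = segment c c'.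
Proof. by have [_ ->] := abc; move=> /six_setP. Qed.

(** Each of the six segments ends at [a] or shares an end with a side that ends at [a]. *)
Lemma star_corner S : F S -> ~ relint S a.
Proof.
have [[Fab Fbc Fca] [Fa Fb Fc]] := star_edges.
have Fba : F (segment b a) by rewrite segmentC.
move=> /star_cases[|[|[|[|[|]]]]] ->.
- exact/relint_l/F_neq.
- exact: shared_endpoint_relint.
- exact/relint_r/F_neq.
- exact/relint_l/F_neq.
- exact: shared_endpoint_relint.
- exact: shared_endpoint_relint.
Qed.

Lemma star_attach S : F S -> relint S a' ->
  S = segment b c \/ S = segment b b' \/ S = segment c c'.
Proof.
have [[Fab Fbc Fca] [Fa Fb Fc]] := star_edges.
move=> /star_cases[|[|[|[|[|]]]]] ->; auto.
- by move/(shared_endpoint_relint Fa Fab).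
- by rewrite segmentC in Fca *; move/(shared_endpoint_relint Fa Fca).
- by move/(relint_r (F_neq Fa)).
Qed.

Lemma corner_attach : ~ corner a' -> [\/ relint (segment b c) a',
  relint (segment b b') a' | relint (segment c c') a'].
Proof.
have [_ [Fa _ _]] := star_edges.
move=> nca; have [S [FS Sa]] : exists S, F S /\ relint S a'.
  apply: contrapT => nS; apply: nca; split; first exact: vertex_r Fa.
  by move=> S FS Sa; apply: nS; exists S.
move: (Sa); case: (star_attach FS Sa) => [|[|]] -> ?;
  by [apply: Or31|apply: Or32|apply: Or33].
Qed.

(** A crossing of these two segments contradicts disjointness only if they are distinct. *)
Lemma star_segment_neq : relint (segment a b) c' -> segment a a' <> segment c c'.
Proof.
have [[Fab _ _] [Fa _ _]] := star_edges; have [_ _ ca] := star_neq.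
move=> c'ab /(segment_eq (F_neq Fa))[[/esym //]|[ac' _]].
by move: c'ab; rewrite -ac'; exact/relint_l/F_neq.
Qed.

(** Segments from two corners of a triangle to inner points of the opposite sides cross. *)
Lemma cevians_cross : relint (segment a b) c' -> ~ relint (segment b c) a'.
Proof.
have [[Fab Fbc _] [Fa _ Fc]] := star_edges; have [ab bc _] := star_neq.
move=> c'ab; move: (c'ab) => /(relint_segmentP _ ab)[s [s0 s1 ec']].
move=> /(relint_segmentP _ bc)[t [t0 t1 ea']].
have s0' : 0 < 1 - s by rewrite subr_gt0.
have t0' : 0 < 1 - t by rewrite subr_gt0.
have d0 : 0 < 1 - t + s * t by rewrite addr_gt0 // mulr_gt0.
apply: (star_segment_neq c'ab).
(* Equating barycentric coordinates gives the crossing point, at parameter [s / (1 - t + s * t)] on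
   [segment a a'] and [(1 - t) / (1 - t + s * t)] on [segment c c']. *)
apply: (@relint_eq _ _ (conv (s / (1 - t + s * t)) a a')) => //.
  apply/(relint_segmentP _ (F_neq Fa)); eexists; split; last reflexivity.
    exact: divr_gt0.
  rewrite ltr_pdivrMr // mul1r -subr_gt0.
  have -> : 1 - t + s * t - s = (1 - s) * (1 - t) by ring.
  exact: mulr_gt0.
apply/(relint_segmentP _ (F_neq Fc)); exists ((1 - t) / (1 - t + s * t)); split.
- exact: divr_gt0.
- by rewrite ltr_pdivrMr // mul1r ltrDl mulr_gt0.
- by rewrite ea' ec'; apply/rowP => i; rewrite !mxE; field; rewrite gt_eqF.
Qed.

(** The segment from [c] to [c'] cuts the triangle in two; since [b'] is on it, [a'] lies in the
    half of [b], so the segment from [a] to [a'] has to cross it. *)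
Lemma cevian_separates : relint (segment a b) c' -> relint (segment c c') b' ->
  ~ relint (segment b b') a'.
Proof.
have [[Fab Fbc _] [Fa Fb Fc]] := star_edges; have [ab _ _] := star_neq.
move=> c'ab; move: (c'ab) => /(relint_segmentP _ ab)[r [r0 r1 ec']].
move=> /(relint_segmentP _ (F_neq Fc))[s [s0 s1 eb']].
move=> /(relint_segmentP _ (F_neq Fb))[t [t0 t1 ea']].
have r0' : 0 < 1 - r by rewrite subr_gt0.
have s0' : 0 < 1 - s by rewrite subr_gt0.
have t0' : 0 < 1 - t by rewrite subr_gt0.
have d0 : 0 < r + (1 - r) * (1 - t) by rewrite addr_gt0 // mulr_gt0.
(* At parameter [u] on [segment a a'] the barycentric coordinates of [a] and [b] are in the ratio
   [1 - r] to [r], as along [segment c c']. The coordinate of [c] is then [u * t * (1 - s)], which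
   gives the parameter on [segment c c']. *)
pose u := r / (r + (1 - r) * (1 - t)).
have u0 : 0 < u by exact: divr_gt0.
have u1 : u < 1 by rewrite ltr_pdivrMr // mul1r ltrDl mulr_gt0.
apply: (star_segment_neq c'ab).
apply: (@relint_eq _ _ (conv u a a')) => //.
  by apply/(relint_segmentP _ (F_neq Fa)); exists u.
apply/(relint_segmentP _ (F_neq Fc)); exists (1 - u * t * (1 - s)).
have ut : 0 < u * t * (1 - s) by do 2?[apply: mulr_gt0 => //].
split; last 2 first.
- by rewrite ltrBlDr ltrDl.
- rewrite ea' eb' ec' /u; apply/rowP => i; rewrite !mxE; field.
  by rewrite gt_eqF.
- rewrite subr_gt0 (lt_trans _ u1) // -mulrA gtr_pMr // (lt_trans _ t1) //.
  by rewrite gtr_pMr // ltrBlDr ltrDl.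
Qed.

End Star.

(** Crossing keeps [a'] and [b'] off the other two sides; separation and mutual incidence then leave
    only the case that both lie inside [segment c c']. This is type (b) if they coincide, and type
    (d) after a rotation otherwise. *)
Lemma classify_side a b c a' b' c' : star a b c a' b' c' ->
  ~ corner a' -> ~ corner b' -> relint (segment a b) c' ->
  exists tau, classified tau.
Proof.
move=> abc nca ncb c'ab; have abc1 := star_rot abc; have abc2 := star_rot abc1.
have bac := star_swap abc; have [_ [Fa Fb _]] := star_edges abc.
have c'ba : relint (segment b a) c' by rewrite segmentC.
case: (corner_attach abc nca) => [/(cevians_cross abc c'ab) //|a'B|a'C].
all: case: (corner_attach abc1 ncb) => [|b'C|b'A];
  first by rewrite segmentC => /(cevians_cross bac c'ba).
- by case: (cevian_separates abc c'ab b'C a'B).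
- by case: (mutual_relint Fa Fb b'A a'B).
- have [ab'|ab'] := pselect (a' = b').
  + by exists TypeB, a, b, c, a', b', c'.
  + by exists TypeD, c, a, b, c', a', b'.
- by case: (cevian_separates bac c'ba a'C b'A).
Qed.

(** If no attached segment ends on a side, eight choices remain; mutual incidence leaves the two
    cyclic ones, which are mirror images and both of type (c). *)
Lemma classify_star a b c a' b' c' : star a b c a' b' c' ->
  ~ corner a' -> ~ corner b' -> ~ corner c' -> exists tau, classified tau.
Proof.
move=> abc nca ncb ncc; have abc1 := star_rot abc; have abc2 := star_rot abc1.
have [_ [Fa Fb Fc]] := star_edges abc.
case: (corner_attach abc nca) => [/(classify_side abc1 ncb ncc) //|a'B|a'C];
case: (corner_attach abc1 ncb) => [/(classify_side abc2 ncc nca) //|b'C|b'A];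
case: (corner_attach abc2 ncc) => [/(classify_side abc nca ncb) //|c'A|c'B].
- by exists TypeC, b, a, c, b', a', c'; split=> //; exact: star_swap.
- by case: (mutual_relint Fb Fc c'B b'C).
- by case: (mutual_relint Fa Fb b'A a'B).
- by case: (mutual_relint Fa Fb b'A a'B).
- by case: (mutual_relint Fa Fc c'A a'C).
- by case: (mutual_relint Fb Fc c'B b'C).
- by case: (mutual_relint Fa Fc c'A a'C).
- by exists TypeC, a, b, c, a', b', c'.
Qed.

(** * Invariants separating the four types *)

(** This and the next two properties mention [F] but no labelling, so they can compare types
    obtained from different choices of [a], [b], [c]. *)
Definition subdivided : Prop :=
  exists S v, [/\ F S, vertices F v & relint S v].

Definition doubly_subdivided : Prop := exists S v w,
  [/\ F S, vertices F v, vertices F w, v <> w & relint S v /\ relint S w].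

Definition doubly_attached : Prop := exists S T U v, S <> T /\
  [/\ F S, F T, endpoints S v, endpoints T v & F U /\ relint U v].

Lemma star_vertex a b c a' b' c' v : star a b c a' b' c' -> vertices F v ->
  v = a \/ v = b \/ v = c \/ v = a' \/ v = b' \/ v = c'.
Proof.
move=> abc [S FS]; case: (star_cases abc FS) (F_segments FS) => [|[|[|[|[|]]]]] ->;
  by move=> /is_segmentP /endpoints_segment H /H; tauto.
Qed.

Lemma relint_star_vertex a b c a' b' c' S v : star a b c a' b' c' -> F S ->
  vertices F v -> relint S v -> v = a' \/ v = b' \/ v = c'.
Proof.
move=> abc FS Vv Sv; case: (star_vertex abc Vv) => [|[|[|//]]] e; subst v.
- by case: (star_corner abc FS Sv).
- by case: (star_corner (star_rot abc) FS Sv).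
- by case: (star_corner (star_rot (star_rot abc)) FS Sv).
Qed.

(** Only [a'] could subdivide a segment, but the attached segments end there, and [segment b c]
    shares the end [b] with one of them. *)
Lemma typeA_subdivided a b c a' b' c' : star a b c a' b' c' ->
  of_type TypeA a b c a' b' c' -> ~ subdivided.
Proof.
move=> abc [? ?]; subst b' c'; move=> [S [v [FS Vv Sv]]].
have [[Fab Fbc Fca] [Fa Fb Fc]] := star_edges abc.
have ? : v = a' by case: (relint_star_vertex abc FS Vv Sv) => [|[|]].
subst v; case: (star_attach abc FS Sv) => [|[|]] e; move: Sv; rewrite e.
- exact: shared_endpoint_relint.
- exact/relint_r/F_neq.
- exact/relint_r/F_neq.
Qed.

Lemma typeB_doubly_attached a b c a' b' c' : star a b c a' b' c' ->
  of_type TypeB a b c a' b' c' -> subdivided /\ doubly_attached.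
Proof.
move=> abc [? a'C c'ab]; subst b'.
have [_ [Fa Fb Fc]] := star_edges abc; have [ab _ _] := star_neq abc.
split; first by exists (segment c c'), a'; split=> //; exact: vertex_r Fa.
exists (segment a a'), (segment b a'), (segment c c'), a'; split.
  move=> /(segment_eq (F_neq Fa))[[//]|[]].
  by move/(F_neq Fa).
split=> //.
- by apply/(endpoints_segment _ (F_neq Fa)); right.
- by apply/(endpoints_segment _ (F_neq Fb)); right.
Qed.

Lemma star_endpoint a b c a' b' c' S : star a b c a' b' c' ->
  [/\ a' <> a, a' <> b & a' <> c] -> a' <> b' -> a' <> c' ->
  F S -> endpoints S a' -> S = segment a a'.
Proof.
move=> abc [aa ab ac] ab' ac' FS.
case: (star_cases abc FS) (F_segments FS) => [|[|[|[|[|]]]]] -> //;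
  by move=> /is_segmentP /endpoints_segment H /H[].
Qed.

Lemma star_attached_neq a b c a' b' c' S v : star a b c a' b' c' -> F S ->
  relint S v -> [/\ v <> a, v <> b & v <> c].
Proof.
move=> abc FS Sv; split=> e; subst v.
- exact: star_corner abc _ FS Sv.
- exact: star_corner (star_rot abc) _ FS Sv.
- exact: star_corner (star_rot (star_rot abc)) _ FS Sv.
Qed.

(** A subdividing vertex is one of [a'], [b'], [c'] and none of [a], [b], [c]; being distinct from
    the other two, it is an end of its own attached segment only. *)
Lemma distinct_not_doubly_attached a b c a' b' c' : star a b c a' b' c' ->
  a' <> b' -> b' <> c' -> c' <> a' -> ~ doubly_attached.
Proof.
move=> abc ab bc ca [S [T [U [v [ST [FS FT Sv Tv [FU Uv]]]]]]]; apply: ST.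
have [va vb vc] := star_attached_neq abc FU Uv.
have Vv : vertices F v by exists S.
case: (relint_star_vertex abc FU Vv Uv) => [|[|]] e; subst v.
- by rewrite (star_endpoint abc _ ab (nesym ca) FS Sv) //
             (star_endpoint abc _ ab (nesym ca) FT Tv).
- by rewrite (star_endpoint (star_rot abc) _ bc (nesym ab) FS Sv) //
             (star_endpoint (star_rot abc) _ bc (nesym ab) FT Tv).
- by rewrite (star_endpoint (star_rot (star_rot abc)) _ ca (nesym bc) FS Sv) //
             (star_endpoint (star_rot (star_rot abc)) _ ca (nesym bc) FT Tv).
Qed.

Lemma typeC_subdivided a b c a' b' c' : star a b c a' b' c' ->
  of_type TypeC a b c a' b' c' ->
  [/\ subdivided, ~ doubly_attached & ~ doubly_subdivided].
Proof.
move=> abc [b'A c'B a'C]; have [_ [Fa Fb Fc]] := star_edges abc.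
have ab : a' <> b' by move=> e; subst b'; exact: relint_r (F_neq Fa) b'A.
have bc : b' <> c' by move=> e; subst c'; exact: relint_r (F_neq Fb) c'B.
have ca : c' <> a' by move=> e; subst a'; exact: relint_r (F_neq Fc) a'C.
have AB : segment a a' <> segment b b'.
  by move=> e; move: b'A; rewrite e; exact/relint_r/F_neq.
have BC : segment b b' <> segment c c'.
  by move=> e; move: c'B; rewrite e; exact/relint_r/F_neq.
have CA : segment c c' <> segment a a'.
  by move=> e; move: a'C; rewrite e; exact/relint_r/F_neq.
split.
- by exists (segment c c'), a'; split=> //; exact: vertex_r Fa.
- exact: distinct_not_doubly_attached abc ab bc ca.
- move=> [S [v [w [FS Vv Vw vw [Sv Sw]]]]].
  (* Disjointness determines [S] from the vertex inside it; the three vertices belong to three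
     distinct segments. *)
  have inS p : vertices F p -> relint S p -> [\/ p = a' /\ S = segment c c',
      p = b' /\ S = segment a a' | p = c' /\ S = segment b b'].
    move=> Vp Sp; case: (relint_star_vertex abc FS Vp Sp) => [|[|]] e; subst p.
    + by apply: Or31; split=> //; exact: relint_eq FS Fc Sp a'C.
    + by apply: Or32; split=> //; exact: relint_eq FS Fa Sp b'A.
    + by apply: Or33; split=> //; exact: relint_eq FS Fb Sp c'B.
  by case: (inS v Vv Sv) => -[? ?]; case: (inS w Vw Sw) => -[? ?]; congruence.
Qed.

Lemma typeD_subdivided a b c a' b' c' : star a b c a' b' c' ->
  of_type TypeD a b c a' b' c' ->
  [/\ subdivided, ~ doubly_attached & doubly_subdivided].
Proof.
move=> abc [a'bc b'A c'A bc]; have [_ [Fa Fb Fc]] := star_edges abc.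
have ab : a' <> b' by move=> e; subst b'; exact: relint_r (F_neq Fa) b'A.
have ca : c' <> a' by move=> e; subst a'; exact: relint_r (F_neq Fa) c'A.
split.
- by exists (segment a a'), b'; split=> //; exact: vertex_r Fb.
- exact: distinct_not_doubly_attached abc ab bc ca.
- by exists (segment a a'), b', c'; split=> //; [exact: vertex_r Fb|exact: vertex_r Fc].
Qed.

(** Each type prescribes truth values of the invariants, and any two of the four prescriptions
    contradict each other. *)
Lemma classified_inj tau tau' : classified tau -> classified tau' -> tau = tau'.
Proof.
have inv typ : classified typ -> match typ with
    | TypeA => ~ subdivided
    | TypeB => subdivided /\ doubly_attached
    | TypeC => [/\ subdivided, ~ doubly_attached & ~ doubly_subdivided]
    | TypeD => [/\ subdivided, ~ doubly_attached & doubly_subdivided] end.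
  move=> [a [b [c [a' [b' [c' [abc]]]]]]]; case: typ.
  - exact: typeA_subdivided.
  - exact: typeB_doubly_attached.
  - exact: typeC_subdivided.
  - exact: typeD_subdivided.
move=> /inv + /inv; case: tau; case: tau' => // H H'; exfalso;
  by repeat match goal with K : and3 _ _ _ |- _ => case: K => * end; tauto.
Qed.

End SegmentSystem.


Theorem theorem8 (R : realType) (F : set (set 'rV[R]_2))
  (F_segments : forall S, F S -> is_segment S)
  (F_card : F #= `I_6)
  (F_disjoint : trivIset F (@relint R))
  (F_lines : forall L, is_line L -> ~ (L `&` \bigcup_(S in F) S #= `I_2))
  (F_3conn : three_connected (vertices F) (adjacent F)) :
  exists! tau : combinatorial_type,
    exists a b c a' b' c' : 'rV[R]_2,
      [/\ ~ collinear a b c,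
          F = [set segment a b; segment b c; segment c a;
                   segment a a'; segment b b'; segment c c']
        & of_type tau a b c a' b' c'].
Proof.
have typeP tau : classified F tau <-> exists a b c a' b' c' : 'rV[R]_2,
    [/\ ~ collinear a b c,
        F = [set segment a b; segment b c; segment c a;
                 segment a a'; segment b b'; segment c c']
      & of_type tau a b c a' b' c'].
  split=> -[a [b [c [a' [b' [c' H]]]]]]; exists a, b, c, a', b', c'.
    by case: H => -[].
  by case: H.
have [tau tauP] : exists tau, classified F tau; last first.
  exists tau; split=> [|tau' /typeP]; first exact/typeP.
  exact: (classified_inj F_segments F_disjoint).
have [a [b [c [ca cb cc o]]]] :=
  noncollinear_corners F_segments F_disjoint F_card F_3conn.
have nabc : ~ collinear a b c by apply: orient_collinear; rewrite gt_eqF.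
(* A fourth corner [d] gives type (a) with [d] as the common endpoint; otherwise [a], [b], [c] are
   the only corners. *)
have [[d [cd da db dc]]|nd] := pselect (exists d,
    [/\ corner F d, d <> a, d <> b & d <> c]).
  exists TypeA, a, b, c, d, d, d; split=> //; split=> //.
  apply: (four_corners F_segments F_disjoint) => //.
  have [/eqP ab /eqP bc /eqP ca'] := not_collinear_neq nabc.
  rewrite /= !inE !negb_or ab bc (eq_sym a c) ca' /= andbT.
  by rewrite !(eq_sym _ d); do ?(apply/andP; split); apply/eqP.
have cor v : corner F v -> [\/ v = a, v = b | v = c].
  move=> cv; have [->|/eqP va] := eqVneq v a; first exact: Or31.
  have [->|/eqP vb] := eqVneq v b; first exact: Or32.
  have [->|/eqP vc] := eqVneq v c; first exact: Or33.
  by case: nd; exists v.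
have [a' [b' [c' [eF nca ncb ncc]]]] :=
  three_corners F_segments F_disjoint (And3 ca cb cc) o cor F_card F_3conn F_lines.
exact: (classify_star F_segments F_disjoint (conj nabc eF)).
Qed.
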